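(* Let $\boldsymbol X\in\mathbb R^{n\times p}$, $\boldsymbol y\in\{0,1\}^n$ and $\zeta>0$ be fixed, let $\pi_{\rm loc}$ be a probability density on $(0,\infty)$ with $\pi_{\rm loc}(\lambda)>0$ for $\lambda>0$, and let $P(\boldsymbol\beta\mid\boldsymbol\beta^*,\tau)$ be the marginal transition kernel defined in the context. Let $\epsilon,R>0$. On the small set $\{\boldsymbol\beta^*:\min_j|\beta_j^*/\tau|\ge\epsilon\}$, the kernel satisfies the minorization condition $$P(\boldsymbol\beta\mid\boldsymbol\beta^*,\tau)\ \ge\ \delta(\tau)\,\mathcal N(\boldsymbol\beta;\boldsymbol\mu_R,\boldsymbol\Phi_R^{-1})\qquad\text{for all }\boldsymbol\beta\in\mathbb R^p,$$ where $\boldsymbol\Phi_R=\tfrac12\boldsymbol X^\top\boldsymbol X+\zeta^{-2}\boldsymbol I+R^{-2}\boldsymbol I$, $\boldsymbol\mu_R=\boldsymbol\Phi_R^{-1}\boldsymbol X^\top(\boldsymbol y-\boldsymbol 1/2)$, and $\delta(\tau)>0$ is increasing in $\tau$ and otherwise depends only on $\epsilon$, $R$ and $\pi_{\rm loc}$ (the data $\boldsymbol X,\boldsymbol y$ and $\zeta$ being fixed). Moreover, the minorization holds uniformly on $\boldsymbol\beta^*\in\mathbb R^p$ in case the prior satisfies $\int_0^\infty\lambda^{-1}\pi_{\rm loc}(\lambda)\,d\lambda<\infty$.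
   Context: $\mathcal N(\boldsymbol\beta;\boldsymbol\mu,\boldsymbol\Sigma)$ denotes the Gaussian density at $\boldsymbol\beta$; $\boldsymbol x_i^\top$ are the rows of $\boldsymbol X$. $\mathrm{PG}(1,c)$ is the Pólya-Gamma distribution: the law of $\frac{1}{2\pi^2}\sum_{k\ge1}\frac{g_k}{(k-1/2)^2+c^2/(4\pi^2)}$ with $g_k$ i.i.d. standard exponential. For $\tau>0$ and $\boldsymbol\lambda\in(0,\infty)^p$, $P(\boldsymbol\beta\mid\boldsymbol\beta^*,\tau,\boldsymbol\lambda)$ is the density of $\boldsymbol\beta$ obtained by drawing $\omega_i\sim\mathrm{PG}(1,\boldsymbol x_i^\top\boldsymbol\beta^* )$ independently, $i=1,\dots,n$, and then $\boldsymbol\beta\sim\mathcal N(\boldsymbol\Phi^{-1}\boldsymbol X^\top(\boldsymbol y-\tfrac12\boldsymbol 1),\boldsymbol\Phi^{-1})$ with $\boldsymbol\Phi=\boldsymbol X^\top\mathrm{diag}(\boldsymbol\omega)\boldsymbol X+\zeta^{-2}\boldsymbol I+\tau^{-2}\mathrm{diag}(\boldsymbol\lambda)^{-2}$. Then $$P(\boldsymbol\beta\mid\boldsymbol\beta^*,\tau)=\int P(\boldsymbol\beta\mid\boldsymbol\beta^*,\tau,\boldsymbol\lambda)\prod_j\pi(\lambda_j\mid\beta_j^*,\tau)\,d\boldsymbol\lambda,\qquad \pi(\lambda_j\mid\beta_j^*,\tau)\propto\lambda_j^{-1}\exp\!\Big(-\frac{\beta_j^{*2}}{2\tau^2\lambda_j^2}\Big)\pi_{\rm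 loc}(\lambda_j).$$ This is the transition in $\boldsymbol\beta$, for fixed global scale $\tau$, of the Pólya-Gamma Gibbs sampler for Bayesian logistic regression under the global-local prior $\beta_j\mid\tau,\lambda_j\sim\mathcal N(0,\tau^2\lambda_j^2)$, $\lambda_j\sim\pi_{\rm loc}$, regularized by fictitious data $z_j=0$, $z_j\mid\beta_j\sim\mathcal N(\beta_j,\zeta^2)$. *)

(* Defs.v *)
From HB Require Import structures.
From mathcomp Require Import all_boot all_order all_algebra.
From mathcomp Require Import all_classical all_reals all_analysis.

Set Implicit Arguments.
Unset Strict Implicit.
Unset Printing Implicit Defensive.

Import Order.TTheory GRing.Theory Num.Theory.
Import numFieldNormedType.Exports.

Local Open Scope classical_set_scope.
Local Open Scope ring_scope.

Section tuple_cons.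
Context d (T : measurableType d) (n : nat).

Definition tuple_cons (z : T * n.-tuple T) : n.+1.-tuple T :=
  [tuple of z.1 :: z.2].

Definition tuple_uncons (t : n.+1.-tuple T) : T * n.-tuple T :=
  (tnth t ord0, [tuple of behead t]).

Lemma tuple_consK : cancel tuple_cons tuple_uncons.
Proof. by move=> [x t]; congr pair; apply/val_inj. Qed.

Lemma tuple_unconsK : cancel tuple_uncons tuple_cons.
Proof. by move=> t; rewrite [RHS]tuple_eta; apply/val_inj. Qed.

Lemma measurable_tuple_cons : measurable_fun [set: T * n.-tuple T] tuple_cons.
Proof. exact: measurable_cons. Qed.

HB.instance Definition _ :=
  isMeasurableFun.Build _ _ _ _ tuple_cons measurable_tuple_cons.

Lemma measurable_tuple_uncons :
  measurable_fun [set: n.+1.-tuple T] tuple_uncons.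
Proof.
apply/measurable_fun_pairP; split => /=.
  exact: measurable_tnth.
exact: measurable_behead.
Qed.

End tuple_cons.

Section cons_measure.
Context d (T : measurableType d) (R : realType) (n : nat).
Variables (mu : {sigma_finite_measure set T -> \bar R})
  (nu : {sigma_finite_measure set (n.-tuple T) -> \bar R}).

Definition cons_measure : set (n.+1.-tuple T) -> \bar R :=
  pushforward (mu \x nu)%E (@tuple_cons _ T n).

Let cons_measure0 : cons_measure set0 = 0%E.
Proof. by rewrite /cons_measure /pushforward preimage_set0 measure0. Qed.

Let cons_measure_ge0 A : (0 <= cons_measure A)%E.
Proof. exact: measure_ge0. Qed.

Let cons_measure_sigma_additive : semi_sigma_additive cons_measure.
Proof.
exact: (@measure_semi_sigma_additive _ _ _
  (pushforward (mu \x nu)%E (@tuple_cons _ T n : {mfun _ >-> _}))).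
Qed.

HB.instance Definition _ := isMeasure.Build _ _ _ cons_measure
  cons_measure0 cons_measure_ge0 cons_measure_sigma_additive.

Let cons_measure_sigma_finite : sigma_finite setT cons_measure.
Proof.
have /sigma_finiteP[F [TF ndF Foo]] := sigma_finiteT mu.
have /sigma_finiteP[G [TG ndG Goo]] := sigma_finiteT nu.
exists (fun k => @tuple_uncons _ T n @^-1` (F k `*` G k)).
  rewrite -preimage_bigcup (_ : \bigcup_k _ = setT) ?preimage_setT//.
  rewrite -setXTT TF TG predeqE => -[x t]; split.
    by move=> [k _ []/= Fx Gt]; split; exists k.
  move=> [/= [i _ Fx] [j _ Gt]]; exists (maxn i j) => //; split.
    by move: x Fx; exact/subsetPset/ndF/leq_maxl.
  by move: t Gt; exact/subsetPset/ndG/leq_maxr.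
move=> k; have [mF Fk] := Foo k; have [mG Gk] := Goo k; split.
  rewrite -[X in measurable X]setTI; apply: measurable_tuple_uncons => //.
  exact: measurableX.
rewrite /cons_measure /pushforward -comp_preimage.
rewrite (_ : _ \o _ = id); last by apply/funext => z; exact: tuple_consK.
by rewrite preimage_id product_measure1E// lte_mul_pinfty// ge0_fin_numE.
Qed.

HB.instance Definition _ := Measure_isSigmaFinite.Build _ _ _
  cons_measure cons_measure_sigma_finite.

End cons_measure.

(* Product measure of the mu i; see tuple_measure_box. *)
Fixpoint tuple_measure d (T : measurableType d) (R : realType) (n : nat) :
    ('I_n -> {sigma_finite_measure set T -> \bar R}) ->
    {sigma_finite_measure set (n.-tuple T) -> \bar R} :=
  match n with
  | 0 => fun=> \d_([tuple] : 0.-tuple T)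
  | m.+1 => fun mu =>
      cons_measure (mu ord0) (tuple_measure (fun i => mu (lift ord0 i)))
  end.

Lemma tuple_measure_box d (T : measurableType d) (R : realType) (n : nat)
    (mu : 'I_n -> {sigma_finite_measure set T -> \bar R}) (A : 'I_n -> set T) :
  (forall i, measurable (A i)) ->
  tuple_measure mu [set t | forall i, A i (tnth t i)] = (\prod_i mu i (A i))%E.
Proof.
elim: n mu A => [|n IHn] mu A mA /=.
  by rewrite big_ord0 diracE mem_set//= => -[].
rewrite big_ord_recl -(IHn (fun i => mu (lift ord0 i)) (fun i => A (lift ord0 i)))//.
rewrite /cons_measure /pushforward.
rewrite -(product_measure1E (mu ord0)
  (tuple_measure (fun i => mu (lift ord0 i)))) //; last first.
  rewrite (_ : [set _ | _] =
    \bigcap_(i in [set: 'I_n]) ((@tnth _ T)^~ i @^-1` A (lift ord0 i))); last first.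
    by apply/seteqP; split => t /= h i; [move=> _; exact: h|exact: h].
  apply: fin_bigcap_measurable => // i _.
  by rewrite -[X in measurable X]setTI; exact: measurable_tnth.
congr (product_measure1 _ _ _); apply/seteqP; split=> -[x t]/=.
  move=> h; split; first exact: (h ord0).
  by move=> i; have := h (lift ord0 i); rewrite tnthS.
move=> [h0 h] i; have [j ->|->] := unliftP ord0 i; last exact: h0.
by rewrite tnthS; exact: h.
Qed.

(* S is the covariance matrix, not the precision. *)
Definition gauss_pdf (R : realType) (p : nat) (m : 'cV[R]_p) (S : 'M[R]_p)
    (b : 'cV[R]_p) : R :=
  (Num.sqrt ((2 * pi) ^+ p * \det S))^-1 *
  expR (- (2^-1 * ((b - m)^T *m invmx S *m (b - m)) 0 0)).

Definition independent_RVs (R : realType) d (T : measurableType d)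
    (P : probability T R) (g : nat -> {RV P >-> measurableTypeR R}) : Prop :=
  forall (s : seq nat) (A : nat -> set (measurableTypeR R)),
    uniq s -> (forall k, measurable (A k)) ->
    P (\bigcap_(k in [set` s]) g k @^-1` A k) =
    (\prod_(k <- s) P (g k @^-1` A k))%E.

(* [is_PG c nu]: nu is the Polya-Gamma distribution PG(1, c). The series is
   indexed from 0 and its almost sure sum is the random variable w; the law nu
   does not depend on the probability space realizing the g_k. *)
Definition is_PG (R : realType) (c : R)
    (nu : probability (measurableTypeR R) R) : Prop :=
  exists (d : measure_display) (T : measurableType d) (P : probability T R)
    (g : nat -> {RV P >-> measurableTypeR R}) (w : {RV P >-> measurableTypeR R}),
  [/\ forall k (A : set (measurableTypeR R)), measurable A ->
        distribution P (g k) A = exponential_prob 1 A,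
      independent_RVs g,
      {ae P, forall x,
        ((2 * pi ^+ 2)^-1 * \sum_(0 <= k < N)
          (g k x : R) / ((k.+1%:R - 2^-1) ^+ 2 + c ^+ 2 / (4 * pi ^+ 2)))
        @[N --> \oo] --> (w x : R)}
    & forall A : set (measurableTypeR R), measurable A ->
        nu A = distribution P w A].

Section kernel.
Context (R : realType) (n p : nat).
Variables (X : 'M[R]_(n, p)) (y : 'cV[R]_n) (zeta : R).

Definition PG_precision (tau : R) (lam : p.-tuple (measurableTypeR R))
    (w : n.-tuple (measurableTypeR R)) : 'M[R]_p :=
  X^T *m diag_mx (\row_i (tnth w i : R)) *m X + (zeta ^- 2)%:M +
  tau ^- 2 *: diag_mx (\row_j (tnth lam j : R) ^- 2).

Definition PG_mean (Phi : 'M[R]_p) : 'cV[R]_p :=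
  invmx Phi *m (X^T *m (y - const_mx 2^-1)).

(* P(b | bs, tau, lam): the density at b of the mixture over independent
   w_i ~ PG(1, x_i^T bs). It is extended real valued. *)
Definition cond_kernel (PG : R -> probability (measurableTypeR R) R)
    (b bs : 'cV[R]_p) (tau : R) (lam : p.-tuple (measurableTypeR R)) : \bar R :=
  (\int[tuple_measure (fun i : 'I_n => PG ((X *m bs)%R i ord0))]_w
    (gauss_pdf (PG_mean (PG_precision tau lam w))
               (invmx (PG_precision tau lam w)) b)%:E)%E.

Definition local_weight (pi_loc : R -> R) (tau bj l : R) : R :=
  l^-1 * expR (- (bj ^+ 2 / (2 * tau ^+ 2 * l ^+ 2))) * pi_loc l.

(* pi(l | bj, tau): meaningful when the normalizing integral is finite, which
   holds for bj != 0, and for all bj when l^-1 * pi_loc l is integrable. *)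
Definition local_cond (pi_loc : R -> R) (tau bj l : R) : R :=
  local_weight pi_loc tau bj l /
  \int[lebesgue_measure]_(x in `]0, +oo[) local_weight pi_loc tau bj x.

Definition marg_kernel (PG : R -> probability (measurableTypeR R) R)
    (pi_loc : R -> R) (b bs : 'cV[R]_p) (tau : R) : \bar R :=
  (\int[tuple_measure (fun=> lebesgue_measure)]_(lam in
      [set lam : p.-tuple (measurableTypeR R) |
        forall j, (0 < (tnth lam j : R))%R])
    (cond_kernel PG b bs tau lam *
     (\prod_j local_cond pi_loc tau (bs j ord0) (tnth lam j))%:E))%E.

Definition limit_precision (r : R) : 'M[R]_p :=
  2^-1 *: (X^T *m X) + (zeta ^- 2)%:M + (r ^- 2)%:M.

Definition gauss_minorization (PG : R -> probability (measurableTypeR R) R)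
    (pi_loc : R -> R) (r : R) (small_set : R -> set 'cV[R]_p)
    (delta : R -> R) : Prop :=
  [/\ forall tau, 0 < tau -> 0 < delta tau,
      forall s t, 0 < s -> s < t -> delta s < delta t
    & forall (tau : R) (bs b : 'cV[R]_p), 0 < tau -> small_set tau bs ->
        ((delta tau * gauss_pdf (PG_mean (limit_precision r))
                                (invmx (limit_precision r)) b)%:E
         <= marg_kernel PG pi_loc b bs tau)%E].

End kernel.

(* Main.v *)
(** Given the latent variables, the density of [beta] is Gaussian with precision
[Phi] and linear term [v = X^T (y - 1/2)], that is,
  [(det Phi / (2 pi)^p)^(1/2) exp (- beta^T Phi beta / 2 + v^T beta - v^T Phi^-1 v / 2)].
When all [w_i] lie in [[0, 1/2]] and all [tau lambda_j >= R], one has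
[zeta^-2 I <= Phi <= Phi_R] in the Loewner order, so this density is at least a
positive constant times the same expression for [Phi_R].

The event on [w] has probability at least [(3/8)^n] whatever [beta^*] is: the
series defining [PG(1, c)] is largest at [c = 0], where its mean is at most
[5/16], and Markov's inequality applies.

The event on [lambda_j] has a probability which, by the monotone likelihood ratio
property of [pi(. | beta_j^*, tau)], is smallest when [|beta_j^* / tau|] is, hence
bounded below by its value at [eps], or at [0] when [lambda^-1 pi_loc] is
integrable. This value is nondecreasing in [tau]; the additional factor
[tau / (1 + tau)] makes the bound increase strictly, even for [p = 0]. *)

Require Import Defs.
From HB Require Import structures.
From mathcomp Require Import all_boot all_order all_algebra.
From mathcomp Require Import all_classical all_reals all_analysis.
From mathcomp Require Import ring lra measurable_realfun.

Import Order.TTheory GRing.Theory Num.Theory.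
Import numFieldNormedType.Exports.

Set Implicit Arguments.
Unset Strict Implicit.
Unset Printing Implicit Defensive.

Local Open Scope classical_set_scope.
Local Open Scope ring_scope.

(** * Comparison of Gaussian densities under the Loewner order *)

Lemma mxBE (R : zmodType) (m n : nat) (A B : 'M[R]_(m, n)) i j :
  (A - B) i j = A i j - B i j.
Proof. by rewrite !mxE. Qed.

(** In place of the eigenvalues, the pivots of symmetric elimination are used: each is at least [a],
    and the determinant is their product. The induction splits off one pivot at a time. *)
Lemma exp_le_det (R : realType) (a : R) (p : nat) (A : 'M[R]_p) :
  0 < a -> A^T = A ->
  (forall x : 'cV[R]_p, a * (x^T *m x) 0 0 <= (x^T *m A *m x) 0 0) ->
  a ^+ p <= \det A.
Proof.
move=> a0; elim: p A => [|p IH] A; first by rewrite det_mx00.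
rewrite -[p.+1]/(1 + p)%N in A * => symA posA.
pose al := A 0 0.
pose u := dlsubmx A.
have ulA : ulsubmx A = al%:M.
  by rewrite [LHS]mx11_scalar !mxE /al; congr ((A _ _)%:M); apply/val_inj.
have urA : ursubmx A = u^T by rewrite /u trmx_dlsub symA.
have drA : (drsubmx A)^T = drsubmx A by rewrite trmx_drsub symA.
have AE : A = block_mx al%:M (u^T) u (drsubmx A).
  by rewrite -ulA -urA submxK.
have al_ge : a <= al.
  have := posA (col_mx 1%:M 0).
  rewrite {1}AE tr_col_mx mul_row_block !mul_row_col trmx0 trmx1.
  by rewrite !(mul0mx, mulmx0, mulmx1, mul1mx, addr0) !mxE/= !mulr1n mulr1.
have al0 : al != 0 by rewrite gt_eqF// (lt_le_trans a0).
(* Conjugation by [L] isolates the corner [al] and leaves the Schur complement [S],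
   which inherits the lower bound [a]. *)
pose L : 'M[R]_(1 + p) := block_mx 1%:M 0 (- al^-1 *: u) 1%:M.
pose S := drsubmx A - al^-1 *: (u *m u^T).
have LA : L *m A = block_mx al%:M (u^T)  (0 : 'cV[R]_p) S.
  rewrite /L {1}AE mulmx_block !mul1mx !mul0mx !addr0 mul_mx_scalar scalerA.
  by rewrite mulrN divff// scaleN1r addNr -scalemxAl scaleNr addrC.
have LAL : L *m A *m L^T = block_mx al%:M 0  (0 : 'cV[R]_p) S.
  rewrite LA /L tr_block_mx mulmx_block !trmx1 trmx0 !mulmx1 !mulmx0 !mul0mx.
  rewrite !(addr0, add0r) linearZ/= mul_scalar_mx scalerA mulrN divff//.
  by rewrite scaleN1r addNr.
have symS : S^T = S by rewrite /S linearB/= linearZ/= drA trmx_mul trmxK.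
have posS (x : 'cV[R]_p) : a * (x^T *m x) 0 0 <= (x^T *m S *m x) 0 0.
  have -> : x^T *m S *m x =
      (L^T *m col_mx 0 x)^T *m A *m (L^T *m col_mx (0 : 'M[R]_1) x).
    rewrite trmx_mul trmxK !mulmxA -(mulmxA _ L A) -(mulmxA _ _ L^T) LAL.
    rewrite tr_col_mx mul_row_block mul_row_col trmx0.
    by rewrite !(mul0mx, mulmx0, add0r, addr0).
  (* [L^T] maps [(0, x)] to [(- al^-1 u^T x, x)], a vector at least as long as [x]. *)
  apply: le_trans (posA _); rewrite ler_pM2l//.
  rewrite /L tr_block_mx mul_block_col trmx0 !trmx1 !(mul0mx, mulmx0, add0r).
  rewrite mul1mx tr_col_mx mul_row_col [leRHS]mxE lerDr.
  by rewrite mxE big_ord1 [X in X * _]mxE -expr2 sqr_ge0.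
have -> : \det A = al * \det S.
  have <- : \det (L *m A) = \det A.
    by rewrite det_mulmx /L det_lblock !det1 !mul1r.
  by rewrite LA det_ublock det_scalar1.
rewrite exprS ler_pM ?exprn_ge0 ?(ltW a0)//.
exact: IH.
Qed.

(** Completing the square isolates the three places where [A] enters: the determinant, the quadratic
    form and the constant [v^T A^-1 v]. Each is then bounded on its own. *)
Lemma gauss_pdf_canonical (R : realType) (p : nat) (A : 'M[R]_p)
    (v b : 'cV[R]_p) :
  A^T = A -> 0 < \det A ->
  gauss_pdf (invmx A *m v) (invmx A) b =
  Num.sqrt (\det A / (2 * pi) ^+ p) *
  expR (- (2^-1 * (b^T *m A *m b) 0 0) + (v^T *m b) 0 0
        - 2^-1 * (v^T *m invmx A *m v) 0 0).
Proof.
move=> symA dA.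
have uA : A \in unitmx by rewrite unitmxE unitfE gt_eqF.
have symiA : (invmx A)^T = invmx A by rewrite trmx_inv symA.
rewrite /gauss_pdf invmxK det_inv; congr (_ * expR _).
  rewrite -sqrtrV ?invfM ?invrK 1?mulrC// mulr_ge0 ?exprn_ge0 ?mulr_ge0 ?pi_ge0//.
  by rewrite invr_ge0 ltW.
have bv : (b^T *m v) 0 0 = (v^T *m b) 0 0.
  by rewrite -[in LHS](trmxK (b^T *m v)) mxE trmx_mul trmxK.
have -> : (b - invmx A *m v)^T = b^T - v^T *m invmx A.
  by rewrite [LHS]linearB/= trmx_mul symiA.
rewrite mulmxBl -(mulmxA (v^T) _ A) mulVmx// mulmx1.
rewrite mulmxBl !mulmxBr -(mulmxA (b^T) A (_ *m v)) (mulmxA A) mulmxV// mul1mx !mulmxA.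
rewrite !mxBE.
rewrite bv; lra.
Qed.

(** The linear term [v^T b] is common to both sides. The other factors are compared by
    [det A >= a^p], by [A <= Q] in the quadratic form, and by [v^T A^-1 v <= a^-1 v^T v] against
    [v^T Q^-1 v >= 0]. The resulting constant does not involve [A], hence is uniform in the latent
    variables. *)
Lemma gauss_pdf_ge (R : realType) (p : nat) (a : R) (A Q : 'M[R]_p)
    (v b : 'cV[R]_p) :
  0 < a -> A^T = A -> Q^T = Q ->
  (forall x : 'cV[R]_p, a * (x^T *m x) 0 0 <= (x^T *m A *m x) 0 0) ->
  (forall x : 'cV[R]_p, (x^T *m A *m x) 0 0 <= (x^T *m Q *m x) 0 0) ->
  Num.sqrt (a ^+ p / \det Q) * expR (- (2^-1 * (a^-1 * (v^T *m v) 0 0))) *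
    gauss_pdf (invmx Q *m v) (invmx Q) b <=
  gauss_pdf (invmx A *m v) (invmx A) b.
Proof.
move=> a0 symA symQ posA AQ.
have dA := @exp_le_det _ a _ _ a0 symA posA.
have posQ x := le_trans (posA x) (AQ x).
have dQ := @exp_le_det _ a _ _ a0 symQ posQ.
have ap0 : 0 < a ^+ p by rewrite exprn_gt0.
have dA0 := lt_le_trans ap0 dA; have dQ0 := lt_le_trans ap0 dQ.
have dotC (x z : 'cV[R]_p) : (x^T *m z) 0 0 = (z^T *m x) 0 0.
  by rewrite -[in LHS](trmxK (x^T *m z)) mxE trmx_mul trmxK.
have dot_ge0 (x : 'cV[R]_p) : 0 <= (x^T *m x) 0 0.
  by rewrite mxE sumr_ge0// => i _; rewrite mxE -expr2 sqr_ge0.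
have invE (B : 'M[R]_p) : B^T = B -> 0 < \det B ->
    (v^T *m invmx B *m v) 0 0 = ((invmx B *m v)^T *m B *m (invmx B *m v)) 0 0.
  move=> symB dB; have uB : B \in unitmx by rewrite unitmxE unitfE gt_eqF.
  rewrite trmx_mul trmx_inv symB -(mulmxA (v^T) _ B) mulVmx// mulmx1.
  by rewrite -mulmxA.
have Q0 : 0 <= (v^T *m invmx Q *m v) 0 0.
  by rewrite invE//; apply: le_trans (posQ _); rewrite mulr_ge0// ltW.
(* With [m = A^-1 v], the inequality [|v - a m|^2 >= 0] and [a |m|^2 <= v^T m] give
   [a v^T m <= |v|^2]. *)
have A1 : (v^T *m invmx A *m v) 0 0 <= a^-1 * (v^T *m v) 0 0.
  set m := invmx A *m v.
  have vm : (v^T *m m) 0 0 = (v^T *m invmx A *m v) 0 0 by rewrite -mulmxA.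
  have h1 : a * (m^T *m m) 0 0 <= (v^T *m m) 0 0.
    by rewrite vm invE//; exact: posA.
  have h2 : 0 <= ((v - a *: m)^T *m (v - a *: m)) 0 0 by exact: dot_ge0.
  have h3 : ((v - a *: m)^T *m (v - a *: m)) 0 0 =
      (v^T *m v) 0 0 - 2 * a * (v^T *m m) 0 0 + a ^+ 2 * (m^T *m m) 0 0.
    have -> : (v - a *: m)^T = v^T - a *: m^T by rewrite [LHS]linearB/= linearZ.
    rewrite mulmxBl !mulmxBr -!scalemxAl -!scalemxAr.
    rewrite !mxBE ![(_ *: _ : 'M[R]_1) _ _]mxE (dotC m v); lra.
  rewrite -vm mulrC ler_pdivlMr//.
  have : a * (a * (m^T *m m) 0 0) <= a * (v^T *m m) 0 0 by rewrite ler_pM2l.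
  move: h2; rewrite h3; nra.
rewrite !gauss_pdf_canonical// mulrACA; apply: ler_pM.
- by rewrite mulr_ge0 ?sqrtr_ge0.
- by rewrite mulr_ge0 ?expR_ge0.
- have c0 : 0 < (2 * pi : R) ^+ p by rewrite exprn_gt0// mulr_gt0// pi_gt0.
  rewrite -sqrtrM; last by rewrite divr_ge0 ?ltW.
  apply: ler_wsqrtr; rewrite mulrA divfK ?gt_eqF//.
  by rewrite ler_pM2r ?invr_gt0.
- rewrite -expRD ler_expR; have := AQ b; lra.
Qed.

(** * Integrals of nonnegative functions and product measures *)

(** The integral of a nonnegative function is a supremum over the simple functions below it, so
    monotonicity holds for arbitrary nonnegative functions. The mixture integrals over [w] and [lam]
    can thus be bounded below pointwise. *)
Lemma ge0_le_integral_sup d (T : measurableType d) (R : realType)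
    (mu : {measure set T -> \bar R}) (D : set T) (f g : T -> \bar R) :
  (forall x, D x -> 0 <= f x)%E -> (forall x, D x -> f x <= g x)%E ->
  (\int[mu]_(x in D) f x <= \int[mu]_(x in D) g x)%E.
Proof.
move=> f0 fg; have g0 x : D x -> (0 <= g x)%E.
  by move=> Dx; rewrite (le_trans (f0 x Dx))// fg.
rewrite !ge0_integralE//; apply: ub_ereal_sup => _ [h /= hf <-].
apply: ereal_sup_ubound; exists h => //= x; apply: (le_trans (hf x)).
by apply: lee_restrict.
Qed.

Lemma measure_mul_le_integral d (T : measurableType d) (R : realType)
    (mu : {measure set T -> \bar R}) (A : set T) (k : R) (f : T -> \bar R) :
  measurable A -> 0 <= k -> (forall x, 0 <= f x)%E ->
  (forall x, A x -> k%:E <= f x)%E ->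
  (k%:E * mu A <= \int[mu]_x f x)%E.
Proof.
move=> mA k0 f0 kf; rewrite -integral_cst// integral_mkcond.
apply: ge0_le_integral_sup => x _; rewrite patchE; case: ifPn => //.
by rewrite inE => /kf.
Qed.

(** Tonelli, one coordinate at a time: [cons_measure] is the image of a binary product measure. *)
Lemma integral_prod_tuple_measure d (T : measurableType d) (R : realType)
    (n : nat) (mu : 'I_n -> {sigma_finite_measure set T -> \bar R})
    (f : 'I_n -> T -> R) :
  (forall i, measurable_fun setT (f i)) -> (forall i x, 0 <= f i x) ->
  (\int[tuple_measure mu]_t (\prod_i f i (tnth t i))%:E =
   \prod_i \int[mu i]_x (f i x)%:E)%E.
Proof.
elim: n mu f => [|n IH] mu f mf f0.
  under eq_integral do rewrite big_ord0.
  by rewrite big_ord0 integral_cst//= diracT mul1e.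
have mtnth m (g : 'I_m -> T -> R) : (forall i, measurable_fun setT (g i)) ->
    measurable_fun [set: m.-tuple T] (fun t => (\prod_i g i (tnth t i))%:E).
  move=> mg; apply/measurable_EFinP; apply: measurable_prod => i _.
  by apply: measurableT_comp => //; exact: measurable_tnth.
rewrite big_ord_recl -(IH (fun i => mu (lift ord0 i)))//=.
set nu := tuple_measure _.
have nu_ge0 : (0 <= \int[nu]_t (\prod_i f (lift ord0 i) (tnth t i))%:E)%E.
  by apply: integral_ge0 => t _; rewrite lee_fin prodr_ge0.
rewrite ge0_integral_pushforward//=; last 2 first.
- exact: mtnth.
- by move=> t _; rewrite lee_fin prodr_ge0.
rewrite preimage_setT.
pose F (z : T * n.-tuple T) :=
  ((f ord0 z.1)%:E * (\prod_i f (lift ord0 i) (tnth z.2 i))%:E)%E.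
rewrite (eq_integral F)/=; last first.
  move=> z _; rewrite /F -EFinM big_ord_recl/=; congr (_ * _)%:E.
  by apply: eq_bigr => i _; rewrite tnthS.
rewrite fubini_tonelli1/=; last 2 first.
- rewrite /F; apply: emeasurable_funM; last first.
    by apply: (measurableT_comp (mtnth n (fun i => f (lift ord0 i)) _)
      measurable_snd).
  by apply/measurable_EFinP; exact: measurableT_comp.
- by move=> z; rewrite mule_ge0// lee_fin// prodr_ge0.
rewrite /fubini_F/= -ge0_integralZr//; last 2 first.
- exact/measurable_EFinP.
- by move=> x _; rewrite lee_fin.
apply: eq_integral => x _; rewrite /F/= ge0_integralZl_EFin//.
- by move=> t _; rewrite lee_fin prodr_ge0.
- exact: (mtnth n (fun i => f (lift ord0 i))).
Qed.

(** * Mass of the Polya-Gamma laws on [[0, 1/2]] *)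

(** Apply [sin t <= t], a consequence of the mean value theorem, at [t = pi / 4], where the
    double-angle formula gives [sin^2 t = 1/2]. *)
Lemma pi2_ge8 (R : realType) : (8 : R) <= pi ^+ 2.
Proof.
have t0 : 0 < (pi / 4 : R) by rewrite divr_gt0// pi_gt0.
have s0 : 0 < sin (pi / 4 : R).
  by apply: sin_gt0_pihalf; rewrite t0/=; have := pi_gt0 R; lra.
have [c _ sE] : exists2 c : R, c \in `]0, pi / 4[ &
    sin (pi / 4) - sin 0 = cos c * (pi / 4 - 0).
  by apply: MVT => //; exact/continuous_subspaceT/continuous_sin.
have st : sin (pi / 4 : R) <= pi / 4.
  by move: sE; rewrite sin0 !subr0 => ->; rewrite ler_piMl ?cos_le1// ltW.
have := cos_pihalf R.
rewrite (_ : (pi : R) / 2 = (pi / 4) *+ 2); last by rewrite mulr2n; field.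
rewrite cos_mulr2n cos2sin2 => h.
have : sin (pi / 4 : R) ^+ 2 <= (pi / 4) ^+ 2.
  by rewrite ler_pXn2r// nnegrE ltW.
rewrite expr_div_n; move: h; rewrite mulr2n; lra.
Qed.

(** The first term is 4, and the others telescope: [(m + 1/2)^-2 <= 1 / (m (m + 1)) = 1/m - 1/(m +
    1)]. Keeping the remainder [- 1/(N + 1)] makes the induction go through. *)
Lemma sum_inv_half_sqr (R : realType) (N : nat) :
  \sum_(0 <= k < N.+1) ((k.+1%:R - 2^-1) ^+ 2)^-1 <= 5 - N.+1%:R^-1 :> R.
Proof.
elim: N => [|N IH].
  by rewrite big_nat1 invr1 (_ : 1 - 2^-1 = 2^-1 :> R) ?exprVn ?invrK; lra.
rewrite big_nat_recr//=; apply: (le_trans (lerD IH (lexx _))).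
have n0 : 0 < N.+1%:R :> R by [].
rewrite -[N.+2%:R]natr1; move: (N.+1%:R : R) n0 => n n0.
suff : ((n + 1 - 2^-1) ^+ 2)^-1 <= n^-1 - (n + 1)^-1.
  by move: (_ ^-1) n^-1 (n + 1)^-1 => a b c; lra.
have -> : n^-1 - (n + 1)^-1 = (n * (n + 1))^-1.
  by field; rewrite !gt_eqF// addr_gt0.
by rewrite lef_pV2 ?posrE ?mulr_gt0 ?exprn_gt0//; nra.
Qed.

Lemma ae_exponential_ge0 d (T : measurableType d) (R : realType)
    (P : probability T R) (g : {RV P >-> measurableTypeR R}) :
  (forall A : set (measurableTypeR R), measurable A ->
     distribution P g A = exponential_prob 1 A) ->
  {ae P, forall x, 0 <= (g x : R)}.
Proof.
move=> gE; exists (g @^-1` `]-oo, 0[); split.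
- exact: measurable_funPTI.
- rewrite [LHS]gE//; apply: integral0_eq => x /=.
  by rewrite in_itv/= => x0; rewrite lt0_exponential_pdf.
- by move=> x /= /negP; rewrite -ltNge in_itv.
Qed.

(** Layer-cake formula: the mean is the integral of [P(|g| > x) <= 1 - P(0 <= g <= x) <= exp (- x)],
    which at rate 1 is the exponential density itself. The absolute value gives nonnegativity
    everywhere and not only almost surely. *)
Lemma integral_normr_exponential_le1 d (T : measurableType d) (R : realType)
    (P : probability T R) (g : {RV P >-> measurableTypeR R}) :
  (forall A : set (measurableTypeR R), measurable A ->
     distribution P g A = exponential_prob 1 A) ->
  (\int[P]_x `|g x : R|%:E <= 1)%E.
Proof.
move=> gE.
have mX : measurable_fun setT (fun x => `|g x : R|).
  exact: measurableT_comp.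
pose X : {RV P >-> R} := HB.pack (fun x => `|g x : R|) (isMeasurableFun.Build _ _ _ _ _ mX).
rewrite -[leLHS](expectation_def X).
rewrite ge0_expectation_ccdf; last by move=> x; exact: normr_ge0.
have pdf0 x : 0 <= exponential_pdf (1 : R) x by exact: exponential_pdf_ge0.
have mpdf := measurable_exponential_pdf (1 : R).
rewrite -(integral_exponential_pdf (@ltr01 R)).
apply: (@le_trans _ _ (\int[lebesgue_measure]_(x in `[0%R, +oo[)
  (exponential_pdf 1 x)%:E)%E); last first.
  apply: ge0_subset_integral => //.
    exact/measurable_EFinP.
  by move=> x _; rewrite lee_fin.
apply: ge0_le_integral_sup => x; rewrite /= in_itv/= andbT => x0.
  exact: measure_ge0.
rewrite exponential_pdfE// mul1r.
have mI : measurable (X @^-1` `]x, +oo[).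
  exact: measurable_funPTI.
have mJ : measurable (g @^-1` `[0, x]).
  exact: measurable_funPTI.
have PJ : (1 - (expR (- 1 * x))%:E <= P (g @^-1` `[0%R, x]))%E.
  have := gE [set` `[0, x]] (measurable_itv _); rewrite /distribution/pushforward/= => ->.
  move: x0; rewrite le_eqVlt => /predU1P[<-|x0].
    by rewrite mulr0 expR0 subee//; apply: integral_ge0 => z _; rewrite lee_fin.
  by rewrite exponential_prob_itv0c.
have : (P (X @^-1` `]x, +oo[) + P (g @^-1` `[0%R, x]) <= 1)%E.
  rewrite -measureU//; first by apply: probability_le1; exact: measurableU.
  apply/seteqP; split => // z [/=]; rewrite !in_itv/= andbT => h /andP[z0 zx].
  by move: h; rewrite ltNge ger0_norm ?zx.
have fX := fin_num_measure P _ mI; have fJ := fin_num_measure P _ mJ.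
rewrite -[ccdf X x]/(P (X @^-1` `]x, +oo[)); move: PJ.
rewrite -(fineK fX) -(fineK fJ) -EFinB -EFinD !lee_fin.
by move: (fine _) (fine _) (expR _) => a b c; lra.
Qed.

Lemma is_PG_itv_ge (R : realType) (c : R)
    (nu : probability (measurableTypeR R) R) :
  is_PG c nu -> ((3 / 8)%R%:E <= nu [set` `[0%R, (2^-1)%R]])%E.
Proof.
move=> [d [T [P [g [w [gE _ gw nuE]]]]]].
rewrite nuE//.
pose a k : R := (2 * pi ^+ 2)^-1 * ((k.+1%:R - 2^-1) ^+ 2)^-1.
have p0 : 0 <= (2 * pi ^+ 2)^-1 :> R by rewrite invr_ge0 mulr_ge0// sqr_ge0.
have a0 k : 0 <= a k by rewrite mulr_ge0// invr_ge0 sqr_ge0.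
pose h k x : R := a k * `|g k x : R|.
have h0 k x : 0 <= h k x by rewrite mulr_ge0.
have mh k : measurable_fun [set: T] (EFin \o h k).
  apply/measurable_EFinP; apply: measurable_funM => //.
  exact: measurableT_comp.
(* [W] is the series at [c = 0] with each [g k] replaced by its absolute value; it is defined
   everywhere, with values up to [+oo], and can be integrated term by term. *)
pose W x := (\sum_(0 <= k <oo) (h k x)%:E)%E.
have W0 x : (0 <= W x)%E by apply: nneseries_ge0 => k _ _; rewrite lee_fin.
have mW : measurable_fun [set: T] W.
  apply: (@ge0_emeasurable_sum _ _ _ setT (fun k => EFin \o h k) xpredT).
    by move=> k x _ _; rewrite lee_fin.
  by move=> k _; exact: mh.
(* The bound is [5 / (2 pi^2)], with [pi^2 >= 8]. *)
have suma : (\sum_(0 <= k <oo) (a k)%:E <= (5 / 16)%:E)%E.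
  apply: lime_le; first by apply: is_cvg_nneseries => k _ _; rewrite lee_fin.
  apply: nearW => -[|N]; first by rewrite big_geq// lee_fin divr_ge0.
  rewrite sumEFin lee_fin -mulr_sumr.
  have := sum_inv_half_sqr R N.
  move: (\sum_(_ <= _ < _) _) => s sN.
  have s5 : s <= 5 by rewrite (le_trans sN)// lerBlDr lerDl.
  have p8 := pi2_ge8 R.
  rewrite mulrC ler_pdivrMr; last by rewrite mulr_gt0// (lt_le_trans _ p8).
  move: (pi ^+ 2) p8 => q p8; lra.
have intW : (\int[P]_x W x <= (5 / 16)%:E)%E.
  rewrite integral_nneseries//; last by move=> k x _; rewrite lee_fin.
  apply: le_trans suma; apply: lee_nneseries => k _.
    by move=> _; apply: integral_ge0 => x _; rewrite lee_fin.
  under eq_integral do rewrite EFinM.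
  rewrite ge0_integralZl_EFin//.
  - rewrite -[leRHS]mule1; apply: lee_wpmul2l; first by rewrite lee_fin.
    exact: integral_normr_exponential_le1 (gE k).
  - apply/measurable_EFinP; exact: measurableT_comp.
have wW : {ae P, forall x, 0 <= (w x : R) /\ ((w x : R)%:E <= W x)%E}.
  have g0 : {ae P, forall x, forall k, 0 <= (g k x : R)}.
    by apply: ae_foralln => k; exact: ae_exponential_ge0 (gE k).
  apply: filterS2 gw g0 => x gw g0.
  have den k : 0 < (k.+1%:R - 2^-1) ^+ 2 :> R.
    rewrite exprn_gt0// subr_gt0 (@lt_le_trans _ _ 1)// ?ler1n//.
    by rewrite invf_lt1// ltr1n.
  have c0 : 0 <= c ^+ 2 / (4 * pi ^+ 2) :> R.
    by rewrite divr_ge0 ?sqr_ge0// mulr_ge0// sqr_ge0.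
  split.
    apply: (cvgr_to_ge gw); apply: nearW => N; rewrite mulr_ge0//.
    by apply: sumr_ge0 => k _; rewrite divr_ge0// addr_ge0// ltW.
  have [->|Wfin] := eqVneq (W x) +oo%E; first by rewrite leey.
  have Wf : W x \is a fin_num by rewrite ge0_fin_numE// ltey.
  rewrite -(fineK Wf) lee_fin; apply: (cvgr_to_le gw); apply: nearW => N.
  rewrite -lee_fin (fineK Wf).
  apply: (@le_trans _ _ (\sum_(0 <= k < N) (h k x)%:E)%E); last first.
    by apply: nneseries_lim_ge => k _ _; rewrite lee_fin.
  rewrite sumEFin lee_fin mulr_sumr; apply: ler_sum => k _.
  rewrite /h /a -[leRHS]mulrA ler_wpM2l// [leRHS]mulrC ger0_norm// ler_wpM2l//.
  by rewrite lef_pV2 ?posrE// ?lerDl// ltr_wpDr.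
set A := w @^-1` [set` `[0%R, (2^-1)%R]].
have mA : measurable A by exact: measurable_funPTI.
(* Markov's inequality: outside [A], almost surely [w > 1/2], hence [W >= 1/2]. So
   [P A >= 1 - 2 * 5/16 = 3/8]. *)
have : ((2^-1)%:E * P (~` A) <= (5 / 16)%:E)%E.
  apply: le_trans intW; rewrite -integral_cst//; last exact: measurableC.
  rewrite integral_mkcond; apply: ae_ge0_le_integral => //.
  - by move=> x _; rewrite patchE; case: ifP => // _; rewrite lee_fin.
  - apply/(measurable_restrictT _ _).1 => //; exact: measurableC.
  - apply: filterS wW => x [w0 wW] _; rewrite patchE; case: ifPn => //.
    rewrite inE /A/= in_itv/= w0/= => /negP; rewrite -ltNge => w2.
    by apply: le_trans wW; rewrite lee_fin ltW.
rewrite probability_setC//.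
have fA := fin_num_measure P _ mA.
rewrite -[distribution P w _]/(P A) -(fineK fA) -EFinB -EFinM !lee_fin.
by move: (fine _) => q; lra.
Qed.

(** * Tails of the conditional law of a local scale *)

(** Reduces everything to [tau = 1] with the single parameter [b / tau], which is why the small set
    constrains [|beta_j^* / tau|]. *)
Lemma local_weight_rescale (R : realType) (pi_loc : R -> R) (tau b l : R) :
  local_weight pi_loc tau b l = local_weight pi_loc 1 (b / tau) l.
Proof.
rewrite /local_weight; congr (_ * expR (- _) * _).
by rewrite expr_div_n expr1n mulr1 !invfM; ring.
Qed.

Section local_weight.
Context (R : realType) (pi_loc : R -> R).
Hypothesis pi_loc_meas :
  measurable_fun (`]0, +oo[ : set (measurableTypeR R)) pi_loc.
Hypothesis pi_loc_gt0 : forall l : R, 0 < l -> 0 < pi_loc l.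
Hypothesis pi_loc_int1 :
  (\int[lebesgue_measure]_(l in `]0%R, +oo[) (pi_loc l)%:E = 1)%E.

Local Notation mu := (@lebesgue_measure R).
Local Notation q := (local_weight pi_loc 1).
Local Notation int_q b :=
  (\int[mu]_(l in `]0%R, +oo[) (local_weight pi_loc 1 b l)%:E)%E.

Lemma local_weight_gt0 (b l : R) : 0 < l -> 0 < q b l.
Proof. by move=> l0; rewrite !mulr_gt0 ?invr_gt0 ?expR_gt0 ?pi_loc_gt0. Qed.

Lemma measurable_local_weight (b : R) :
  measurable_fun (`]0, +oo[ : set (measurableTypeR R)) (q b).
Proof.
apply: measurable_funM => //.
apply: open_continuous_measurable_fun; first exact: interval_open.
move=> l; rewrite inE /= in_itv/= andbT => l0.
have l0' : l != 0 by rewrite gt_eqF.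
apply: cvgM; first by apply: cvgV => //; exact: cvg_id.
apply: continuous_comp; last exact: continuous_expR.
apply: cvgN; apply: cvgM; first exact: cvg_cst.
apply: cvgV; first by rewrite expr1n mulr1 mulf_neq0// expf_neq0.
apply: cvgM; first exact: cvg_cst.
exact: exprn_continuous.
Qed.

Lemma local_weight_le_norm (a b l : R) : 0 <= a -> a <= `|b| -> 0 < l ->
  q b l <= q a l.
Proof.
move=> a0 ab l0; apply: ler_wpM2r; first by rewrite ltW ?pi_loc_gt0.
apply: ler_wpM2l; first by rewrite invr_ge0 ltW.
rewrite ler_expR lerN2; apply: ler_wpM2r.
  by rewrite invr_ge0 !mulr_ge0 ?exprn_ge0// ltW.
by rewrite -(real_normK (num_real b)) ler_sqr ?nnegrE.
Qed.

(** One finite integral, at [eps] or at [0], serves for all points of the small set. *)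
Lemma local_weight_integrable_le (a b : R) : 0 <= a -> a <= `|b| ->
  (int_q a < +oo)%E -> mu.-integrable `]0, +oo[ (EFin \o q b).
Proof.
move=> a0 ab fa; have pos l : `]0, +oo[%classic l -> 0 < l.
  by rewrite /= in_itv/= andbT.
apply/integrableP; split.
  by apply/measurable_EFinP; exact: measurable_local_weight.
apply: le_lt_trans fa; apply: ge0_le_integral_sup => l /pos l0 //=.
by rewrite gtr0_norm ?local_weight_gt0// lee_fin local_weight_le_norm.
Qed.

(* Since [2 a l <= a^2 + l^2], the factor [l^-1 exp (- a^2 / (2 l^2))] is at
   most [2 l / (2 l^2 + a^2) <= a^-1]. *)
Lemma local_weight_int_lty (a : R) : 0 < a -> (int_q a < +oo)%E.
Proof.
move=> a0; have pos l : `]0, +oo[%classic l -> 0 < l.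
  by rewrite /= in_itv/= andbT.
apply: (@le_lt_trans _ _ (\int[mu]_(l in `]0%R, +oo[) (a^-1%:E * (pi_loc l)%:E))%E).
  apply: ge0_le_integral_sup => l /pos l0; first by rewrite lee_fin ltW ?local_weight_gt0.
  rewrite -EFinM lee_fin; apply: ler_wpM2r; first by rewrite ltW ?pi_loc_gt0.
  rewrite expr1n mulr1 expRN -invfM lef_pV2 ?posrE ?mulr_gt0 ?expR_gt0//.
  apply: (@le_trans _ _ (l * (1 + a ^+ 2 / (2 * l ^+ 2)))); last first.
    by rewrite ler_wpM2l ?expR_ge1Dx// ltW.
  have -> : l * (1 + a ^+ 2 / (2 * l ^+ 2)) = (2 * l ^+ 2 + a ^+ 2) / (2 * l).
    by field; rewrite gt_eqF.
  rewrite ler_pdivlMr ?mulr_gt0//; have := sqr_ge0 (l - a); nra.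
rewrite ge0_integralZl_EFin//.
- by rewrite pi_loc_int1 mule1 ltry.
- by move=> l /pos l0; rewrite lee_fin ltW// pi_loc_gt0.
- exact/measurable_EFinP.
- by rewrite invr_ge0 ltW.
Qed.

(** Probability of [l >= L] under [pi(. | b, 1)]; it is used at [L = r / tau], where the event reads
    [tau l >= r]. *)
Definition local_tail (b L : R) : R :=
  (\int[mu]_(l in `[L, +oo[) q b l) / \int[mu]_(l in `]0, +oo[) q b l.

Lemma sub_itv_pos (L : R) : 0 < L -> `[L, +oo[ `<=` (`]0, +oo[ : set R).
Proof. by move=> L0; apply: subset_itvr; rewrite bnd_simp. Qed.

(** If the integral were zero, the weight would vanish almost everywhere on the half-line; being
    positive at every point there, it would force a set of infinite measure to be negligible. *)
Lemma Rintegral_tail_gt0 (b L : R) : 0 < L ->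
  mu.-integrable `]0, +oo[ (EFin \o q b) -> 0 < \int[mu]_(l in `[L, +oo[) q b l.
Proof.
move=> L0 iq; have sub := sub_itv_pos L0.
have pos l : `[L, +oo[%classic l -> 0 < l.
  by rewrite /= in_itv/= andbT; exact: lt_le_trans.
have iqL : mu.-integrable `[L, +oo[ (EFin \o q b) by exact: integrableS iq.
rewrite lt0r Rintegral_ge0 ?andbT; last first.
  by move=> l /pos l0; rewrite ltW ?local_weight_gt0.
apply/negP => /eqP i0.
have : (\int[mu]_(l in `[L, +oo[) `|(EFin \o q b) l| = 0)%E.
  under eq_integral => l lL.
    rewrite gee0_abs; last first.
      by move: lL; rewrite inE lee_fin => /pos l0; rewrite ltW ?local_weight_gt0.
    over.
  rewrite -[LHS]fineK; first by rewrite -[fine _]/(Rintegral _ _ _) i0.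
  exact: integrable_fin_num iqL.
move/ae_eq_integral_abs => /(_ (measurable_itv _)).
case; first by have /integrableP[] := iqL.
move=> N [mN N0 sN].
have : (mu `[L, +oo[ <= mu N)%E.
  apply: le_measure; rewrite ?inE//.
  apply: subset_trans sN => l lL /= /(_ lL) [] /eqP.
  by rewrite gt_eqF// local_weight_gt0// pos.
by rewrite N0 lebesgue_measure_itv/= ltry leye_eq.
Qed.

Lemma Rintegral_split_tail (b L : R) : 0 < L ->
  mu.-integrable `]0, +oo[ (EFin \o q b) ->
  \int[mu]_(l in `]0, +oo[) q b l =
  \int[mu]_(l in `]0, L[) q b l + \int[mu]_(l in `[L, +oo[) q b l.
Proof.
move=> L0 iq.
have UE : (`]0, L[ `|` `[L, +oo[ = `]0, +oo[ :> set R)%classic.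
  by rewrite -itv_bndbnd_setU// bnd_simp// ltW.
rewrite -Rintegral_setU//; first by rewrite UE.
- by rewrite UE.
- apply/disj_setPS => l [] /=; rewrite !in_itv/= andbT => /andP[_ lL] Ll.
  by move: lL; rewrite ltNge Ll.
Qed.

Lemma Rintegral_head_ge0 (b L : R) : 0 <= \int[mu]_(l in `]0, L[) q b l.
Proof.
apply: Rintegral_ge0 => l; rewrite /= in_itv/= => /andP[l0 _].
by rewrite ltW ?local_weight_gt0.
Qed.

Lemma Rintegral_pos_gt0 (b : R) :
  mu.-integrable `]0, +oo[ (EFin \o q b) -> 0 < \int[mu]_(l in `]0, +oo[) q b l.
Proof.
move=> iq; rewrite (@Rintegral_split_tail b 1)//.
by rewrite ltr_wpDl ?Rintegral_head_ge0 ?Rintegral_tail_gt0.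
Qed.

Lemma local_tail_gt0 (b L : R) : 0 < L ->
  mu.-integrable `]0, +oo[ (EFin \o q b) -> 0 < local_tail b L.
Proof.
by move=> L0 iq; rewrite divr_gt0 ?Rintegral_tail_gt0 ?Rintegral_pos_gt0.
Qed.

(** Source of the monotonicity in [tau], since [r / tau] decreases as [tau] grows. *)
Lemma local_tail_nonincr (b L M : R) : 0 < L -> L <= M ->
  mu.-integrable `]0, +oo[ (EFin \o q b) -> local_tail b M <= local_tail b L.
Proof.
move=> L0 LM iq; rewrite ler_wpM2r ?invr_ge0 ?(ltW (Rintegral_pos_gt0 _))//.
have iqL : mu.-integrable `[L, +oo[ (EFin \o q b).
  by apply: integrableS iq => //; exact: sub_itv_pos.
have sub : (`[M, +oo[ `<=` (`[L, +oo[ : set R)).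
  by apply: subset_itvr; rewrite bnd_simp.
rewrite fine_le//.
- by apply: integrable_fin_num => //; exact: integrableS iqL.
- exact: integrable_fin_num iqL.
apply: ge0_subset_integral => //; first by have /integrableP[] := iqL.
move=> l; rewrite /= in_itv/= andbT => Ll.
by rewrite lee_fin ltW// local_weight_gt0// (lt_le_trans L0).
Qed.

(* Monotone likelihood ratio: [q b l / q a l] is nondecreasing in [l], so it is
   at most [k] below [L] and at least [k] above, where [k] is its value at [L]. *)
Lemma local_tail_le (a b L : R) : 0 <= a -> a <= `|b| -> 0 < L ->
  mu.-integrable `]0, +oo[ (EFin \o q a) ->
  mu.-integrable `]0, +oo[ (EFin \o q b) ->
  local_tail a L <= local_tail b L.
Proof.
move=> a0 ab L0 iqa iqb.
(* The likelihood ratio [q b l / q a l] is [exp (- e / l^2)], nondecreasing in [l > 0] because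
   [e >= 0]. *)
pose e : R := (b ^+ 2 - a ^+ 2) / 2.
have e0 : 0 <= e.
  rewrite divr_ge0// subr_ge0 -(real_normK (num_real b)).
  by rewrite ler_sqr ?nnegrE.
pose k := expR (- (e / L ^+ 2)).
have qE l : q b l = expR (- (e / l ^+ 2)) * q a l.
  rewrite /local_weight expr1n mulr1.
  have -> : b ^+ 2 / (2 * l ^+ 2) = e / l ^+ 2 + a ^+ 2 / (2 * l ^+ 2).
    by rewrite /e !invfM; ring.
  by rewrite opprD expRD; ring.
have integrable_sub (c : R) (A : set R) : measurable A -> A `<=` `]0, +oo[ ->
    mu.-integrable `]0, +oo[ (EFin \o q c) -> mu.-integrable A (EFin \o q c).
  by move=> mA sA; exact: integrableS.
have subH : `]0, L[ `<=` (`]0, +oo[ : set R) by exact: subset_itvl.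
have subT := sub_itv_pos L0.
have head : \int[mu]_(l in `]0, L[) q b l <= k * \int[mu]_(l in `]0, L[) q a l.
  have ia := integrable_sub a _ (measurable_itv _) subH iqa.
  rewrite -RintegralZl//; apply: le_Rintegral => //.
  - exact: integrable_sub.
  - exact: (integrableZl _ k ia).
  move=> l; rewrite /= in_itv/= => /andP[l0 lL]; rewrite qE.
  apply: ler_wpM2r; first by rewrite ltW ?local_weight_gt0.
  rewrite ler_expR lerN2 ler_wpM2l// lef_pV2 ?posrE ?exprn_gt0//.
  by rewrite ler_sqr ?nnegrE// ltW.
have tail : k * \int[mu]_(l in `[L, +oo[) q a l <= \int[mu]_(l in `[L, +oo[) q b l.
  have ia := integrable_sub a _ (measurable_itv _) subT iqa.
  rewrite -RintegralZl//; apply: le_Rintegral => //.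
  - exact: (integrableZl _ k ia).
  - exact: integrable_sub.
  move=> l; rewrite /= in_itv/= andbT => Ll; rewrite qE.
  have l0 := lt_le_trans L0 Ll.
  apply: ler_wpM2r; first by rewrite ltW ?local_weight_gt0.
  rewrite ler_expR lerN2 ler_wpM2l// lef_pV2 ?posrE ?exprn_gt0//.
  by rewrite ler_sqr ?nnegrE// ltW.
rewrite /local_tail ler_pdivrMr ?Rintegral_pos_gt0// mulrAC.
rewrite ler_pdivlMr ?Rintegral_pos_gt0//.
rewrite (Rintegral_split_tail L0 iqa) (Rintegral_split_tail L0 iqb).
have := Rintegral_head_ge0 a L; have := Rintegral_tail_gt0 L0 iqa.
move: head tail.
move: (Rintegral _ _ _) (Rintegral _ _ _) (Rintegral _ _ _) (Rintegral _ _ _).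
(* [F] and [G] are the integrals for [a] and [b]; [l] and [h] mark the parts below and above [L].
   Without the common term [Fh * Gh], the goal is [Fh * Gl <= Gh * Fl], and [k * Fh * Fl] lies
   between the two sides. *)
move=> Gh Fh Fl Gl head tail Fh0 Fl0.
have : Fh * Gl <= Fh * (k * Fl) by rewrite ler_wpM2l// ltW.
have : k * Fh * Fl <= Gh * Fl by rewrite ler_wpM2r.
lra.
Qed.

End local_weight.

(** * Lower bounds for the conditional and marginal kernels *)

Section kernel_bounds.
Context (R : realType) (n p : nat).
Variables (X : 'M[R]_(n, p)) (y : 'cV[R]_n) (zeta : R).

(** Makes the facts about [PG_precision] available for [Phi_R], the extreme case of the event where
    [w_i <= 1/2] and [tau lambda_j >= r]. *)
Lemma limit_precisionE (r : R) :
  limit_precision X zeta r =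
  PG_precision X zeta 1 [tuple r | _ < p] [tuple 2^-1 | _ < n].
Proof.
rewrite /limit_precision /PG_precision expr1n invr1 scale1r.
congr (_ + _ + _).
  rewrite (_ : (\row_i _) = const_mx 2^-1).
    by rewrite diag_const_mx mul_mx_scalar -scalemxAl.
  by apply/rowP => i; rewrite !mxE tnth_mktuple.
rewrite (_ : (\row_i _) = const_mx (r ^- 2)) ?diag_const_mx//.
by apply/rowP => i; rewrite !mxE tnth_mktuple.
Qed.

Lemma tr_PG_precision tau lam w :
  (PG_precision X zeta tau lam w)^T = PG_precision X zeta tau lam w.
Proof.
rewrite /PG_precision !linearD/= linearZ/= !tr_diag_mx tr_scalar_mx.
by rewrite !trmx_mul trmxK tr_diag_mx mulmxA.
Qed.

(** In this form, comparing two precisions in the Loewner order amounts to comparing weights term by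
    term. *)
Lemma PG_precision_quad tau lam w (x : 'cV[R]_p) :
  (x^T *m PG_precision X zeta tau lam w *m x) 0 0 =
  \sum_i (tnth w i : R) * (X *m x) i 0 ^+ 2 + zeta ^- 2 * (x^T *m x) 0 0 +
  \sum_j ((tau * tnth lam j : R) ^- 2) * x j 0 ^+ 2.
Proof.
have diag_quad m (d : 'rV[R]_m) (z : 'cV[R]_m) :
    (z^T *m diag_mx d *m z) 0 0 = \sum_i d 0 i * z i 0 ^+ 2.
  rewrite mul_mx_diag mxE; apply: eq_bigr => i _; rewrite !mxE.
  by rewrite mulrAC -expr2 mulrC.
rewrite /PG_precision !mulmxDr !mulmxDl [LHS]mxE [X in X + _]mxE.
congr (_ + _ + _).
- rewrite !mulmxA -trmx_mul -mulmxA diag_quad.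
  by apply: eq_bigr => i _; rewrite mxE.
- by rewrite mul_mx_scalar -scalemxAl mxE.
- rewrite -scalemxAr -scalemxAl mxE diag_quad mulr_sumr.
  by apply: eq_bigr => j _; rewrite mxE exprMn [in RHS]invfM mulrA.
Qed.

(** The constant of [gauss_pdf_ge] for [a = zeta^-2] and [Q = Phi_R]. *)
Definition kernel_const (r : R) : R :=
  let v := X^T *m (y - const_mx 2^-1) in
  Num.sqrt ((zeta ^- 2) ^+ p / \det (limit_precision X zeta r)) *
  expR (- (2^-1 * ((zeta ^- 2)^-1 * (v^T *m v) 0 0))).

Hypothesis zeta_gt0 : 0 < zeta.

Lemma PG_precision_ge tau lam w (x : 'cV[R]_p) :
  (forall i, 0 <= (tnth w i : R)) ->
  zeta ^- 2 * (x^T *m x) 0 0 <= (x^T *m PG_precision X zeta tau lam w *m x) 0 0.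
Proof.
move=> w0; rewrite PG_precision_quad addrAC lerDr addr_ge0// sumr_ge0// => i _.
  by rewrite mulr_ge0// sqr_ge0.
by rewrite mulr_ge0 ?sqr_ge0// invr_ge0 sqr_ge0.
Qed.

Lemma kernel_const_gt0 (r : R) : 0 < kernel_const r.
Proof.
have z0 : 0 < zeta ^- 2 by rewrite invr_gt0 exprn_gt0.
rewrite mulr_gt0 ?expR_gt0// sqrtr_gt0 divr_gt0 ?exprn_gt0//.
rewrite (@lt_le_trans _ _ ((zeta ^- 2) ^+ p)) ?exprn_gt0//.
apply: exp_le_det => //; rewrite limit_precisionE ?tr_PG_precision// => x.
by apply: PG_precision_ge => i; rewrite tnth_mktuple invr_ge0.
Qed.

Lemma gauss_PG_precision_ge (r tau : R) (b : 'cV[R]_p)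
    (lam : p.-tuple (measurableTypeR R)) (w : n.-tuple (measurableTypeR R)) :
  0 < r -> 0 < tau -> (forall j, r / tau <= (tnth lam j : R)) ->
  (forall i, 0 <= (tnth w i : R) <= 2^-1) ->
  kernel_const r * gauss_pdf (PG_mean X y (limit_precision X zeta r))
                     (invmx (limit_precision X zeta r)) b <=
  gauss_pdf (PG_mean X y (PG_precision X zeta tau lam w))
            (invmx (PG_precision X zeta tau lam w)) b.
Proof.
move=> r0 tau0 lamL w01.
apply: gauss_pdf_ge; rewrite ?invr_gt0 ?exprn_gt0//.
- exact: tr_PG_precision.
- by rewrite limit_precisionE tr_PG_precision.
- by move=> x; apply: PG_precision_ge => i; have /andP[] := w01 i.
move=> x; rewrite limit_precisionE !PG_precision_quad.
apply: lerD; first apply: lerD => //.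
  apply: ler_sum => i _; rewrite tnth_mktuple ler_wpM2r ?sqr_ge0//.
  by have /andP[] := w01 i.
apply: ler_sum => j _; rewrite tnth_mktuple mul1r ler_wpM2r ?sqr_ge0//.
have rl : r <= tau * tnth lam j by rewrite mulrC -ler_pdivrMr.
rewrite lef_pV2 ?posrE ?exprn_gt0// ?(lt_le_trans r0)//.
by rewrite ler_sqr ?nnegrE ?(le_trans (ltW r0))// ltW.
Qed.

Variable PG : R -> probability (measurableTypeR R) R.
Hypothesis PG_law : forall c : R, is_PG c (PG c).

Lemma gauss_pdf_ge0 (m b : 'cV[R]_p) (S : 'M[R]_p) : 0 <= gauss_pdf m S b.
Proof. by rewrite mulr_ge0 ?expR_ge0// invr_ge0 sqrtr_ge0. Qed.

(** Only the box [[0, 1/2]^n] is kept in the integral over [w]; its mass is a product of [n]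
    factors, each at least [3/8]. *)
Lemma cond_kernel_ge (r tau : R) (b bs : 'cV[R]_p)
    (lam : p.-tuple (measurableTypeR R)) :
  0 < r -> 0 < tau -> (forall j, r / tau <= (tnth lam j : R)) ->
  ((kernel_const r * gauss_pdf (PG_mean X y (limit_precision X zeta r))
                     (invmx (limit_precision X zeta r)) b * (3 / 8) ^+ n)%R%:E
   <= cond_kernel X y zeta PG b bs tau lam)%E.
Proof.
move=> r0 tau0 lamL.
pose I01 : set (measurableTypeR R) := [set` `[0, 2^-1]].
pose A := [set w : n.-tuple (measurableTypeR R) | forall i, I01 (tnth w i)].
have mI01 : measurable I01 by exact: measurable_itv.
have mA : measurable A.
  rewrite (_ : A = \bigcap_(i in [set: 'I_n])
      ((fun t => tnth t i) @^-1` I01)); last first.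
    by apply/seteqP; split => t /= h i; [move=> _; exact: h|exact: h].
  apply: fin_bigcap_measurable => // i _.
  by rewrite -[X in measurable X]setTI; exact: measurable_tnth.
set k := _ * gauss_pdf _ _ _.
have k0 : 0 <= k.
  by rewrite mulr_ge0 ?gauss_pdf_ge0// ltW// kernel_const_gt0.
apply: (@le_trans _ _ (k%:E * tuple_measure
    (fun i : 'I_n => PG ((X *m bs)%R i ord0)) A)%E); last first.
  apply: measure_mul_le_integral => //.
    by move=> w; rewrite lee_fin gauss_pdf_ge0.
  by move=> w wA; rewrite lee_fin; exact: gauss_PG_precision_ge.
rewrite EFinM; apply: lee_wpmul2l; first by rewrite lee_fin.
rewrite (@tuple_measure_box _ _ _ _ _ (fun=> I01))//.
pose f i := fine (PG ((X *m bs) i ord0) I01).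
have fE i : PG ((X *m bs) i ord0) I01 = (f i)%:E.
  by rewrite fineK// fin_num_measure.
rewrite (eq_bigr (EFin \o f)); last by move=> i _; exact: fE.
rewrite prodEFin lee_fin -[in leLHS](card_ord n) -prodr_const.
apply: ler_prod => i _; apply/andP; split; first by rewrite divr_ge0.
by rewrite -lee_fin -fE; exact: is_PG_itv_ge.
Qed.

Variable pi_loc : R -> R.
Hypothesis pi_loc_meas :
  measurable_fun (`]0, +oo[ : set (measurableTypeR R)) pi_loc.
Hypothesis pi_loc_gt0 : forall l : R, 0 < l -> 0 < pi_loc l.
Local Notation mu := (@lebesgue_measure R).

(** Extending the truncated density by zero makes the integral run over the whole line, as
    [integral_prod_tuple_measure] requires. *)
Lemma integral_local_cond (tau bj L : R) : 0 < L ->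
  mu.-integrable `]0, +oo[ (EFin \o local_weight pi_loc 1 (bj / tau)) ->
  (\int[mu]_x ((local_cond pi_loc tau bj \_ `[L, +oo[) x)%:E =
   (local_tail pi_loc (bj / tau) L)%:E)%E.
Proof.
move=> L0 iq.
have iqL : mu.-integrable `[L, +oo[ (EFin \o local_weight pi_loc 1 (bj / tau)).
  by apply: integrableS iq => //; exact: sub_itv_pos.
have lcE x : local_cond pi_loc tau bj x = local_weight pi_loc 1 (bj / tau) x *
    (\int[mu]_(l in `]0, +oo[) local_weight pi_loc 1 (bj / tau) l)^-1.
  rewrite /local_cond local_weight_rescale; congr (_ / _).
  by apply: eq_Rintegral => l _; rewrite local_weight_rescale.
rewrite /local_tail -RintegralZr//.
transitivity (\int[mu]_(x in `[L, +oo[) (local_cond pi_loc tau bj x)%:E)%E.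
  rewrite [RHS]integral_mkcond; apply: eq_integral => x _.
  by rewrite -[in RHS]/(EFin \o local_cond pi_loc tau bj) restrict_EFin.
under eq_integral do rewrite /= lcE.
rewrite fineK//; apply: integrable_fin_num => //.
exact: (integrableZr _ _ iqL).
Qed.

(** Common form of the two claims, with [a = eps] on the small set and [a = 0] in the uniform case.
    In the constant, [(3/8)^n] comes from [w] and the power of [local_tail] from [lam]. *)
Lemma marg_kernel_minorization (r a : R) (small_set : R -> set 'cV[R]_p) :
  0 < r -> 0 <= a ->
  (\int[mu]_(l in `]0%R, +oo[) (local_weight pi_loc 1 a l)%:E < +oo)%E ->
  (forall tau bs, small_set tau bs -> forall j, a <= `|bs j 0 / tau|) ->
  gauss_minorization X y zeta PG pi_loc r small_set (fun tau =>
    kernel_const r * (3 / 8) ^+ n * (tau / (1 + tau)) *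
    local_tail pi_loc a (r / tau) ^+ p).
Proof.
move=> r0 a0 qa_fin small.
have iqa : mu.-integrable `]0, +oo[ (EFin \o local_weight pi_loc 1 a).
  by apply: (@local_weight_integrable_le _ _ _ _ a a) => //; rewrite ger0_norm.
have c0 : 0 < kernel_const r * (3 / 8) ^+ n.
  by rewrite mulr_gt0 ?kernel_const_gt0// exprn_gt0// divr_gt0.
have tail0 tau : 0 < tau -> 0 < local_tail pi_loc a (r / tau).
  by move=> tau0; rewrite local_tail_gt0// divr_gt0.
split.
- move=> tau tau0; rewrite mulr_gt0//; last by rewrite exprn_gt0 ?tail0.
  by rewrite mulr_gt0// divr_gt0// addr_gt0.
- move=> s t s0 st; have t0 := lt_trans s0 st.
  (* Pass from [s] to [t] first in [tau / (1 + tau)], where the increase is strict, then in the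
     tail, where it may be weak. *)
  apply: (@lt_le_trans _ _ (kernel_const r * (3 / 8) ^+ n * (t / (1 + t)) *
    local_tail pi_loc a (r / s) ^+ p)).
    rewrite ltr_pM2r ?exprn_gt0 ?tail0// ltr_pM2l//.
    rewrite ltr_pdivrMr ?addr_gt0// mulrAC ltr_pdivlMr ?addr_gt0//; lra.
  rewrite ler_pM2l; last by rewrite mulr_gt0// divr_gt0// addr_gt0.
  apply: lerXn2r; rewrite ?nnegrE; [exact/ltW/tail0|exact/ltW/tail0|].
  apply: local_tail_nonincr => //; first by rewrite divr_gt0.
  by rewrite ler_pM2l// lef_pV2 ?posrE// ltW.
move=> tau bs b tau0 /small bs_ge.
set N := gauss_pdf _ _ _; set L := r / tau.
have L0 : 0 < L by rewrite divr_gt0.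
have iqb j : mu.-integrable `]0, +oo[
    (EFin \o local_weight pi_loc 1 (bs j ord0 / tau)).
  exact: (@local_weight_integrable_le _ _ _ _ a).
pose f j := local_cond pi_loc tau (bs j ord0) \_ `[L, +oo[.
have lc_ge0 j l : 0 < l -> 0 <= local_cond pi_loc tau (bs j ord0) l.
  move=> l0; rewrite divr_ge0//.
    by rewrite local_weight_rescale ltW ?local_weight_gt0.
  apply: Rintegral_ge0 => x; rewrite /= in_itv/= andbT => x0.
  by rewrite local_weight_rescale ltW ?local_weight_gt0.
have f0 j x : 0 <= f j x.
  rewrite /f patchE; case: ifPn => //; rewrite inE/= in_itv/= andbT => Lx.
  exact/lc_ge0/(lt_le_trans L0).
have mf j : measurable_fun [set: measurableTypeR R] (f j).
  apply/(measurable_restrictT _ _).1 => //.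
  apply: measurable_funM => //.
  rewrite (_ : local_weight pi_loc tau _ =
    local_weight pi_loc 1 (bs j ord0 / tau)); last first.
    by apply/funext => l; rewrite local_weight_rescale.
  exact: (measurable_funS _ (sub_itv_pos L0) (measurable_local_weight pi_loc_meas _)).
set C := kernel_const r * N * (3 / 8) ^+ n.
have C0 : 0 <= C.
  by rewrite mulr_ge0 ?exprn_ge0 ?divr_ge0// mulr_ge0 ?gauss_pdf_ge0// ltW ?kernel_const_gt0.
have step1 : ((C * \prod_j local_tail pi_loc (bs j ord0 / tau) L)%:E <=
    marg_kernel X y zeta PG pi_loc b bs tau)%E.
  rewrite EFinM -prodEFin.
  under eq_bigr do rewrite -integral_local_cond//.
  rewrite -(@integral_prod_tuple_measure _ _ _ _ (fun=> mu) f)//.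
  rewrite -ge0_integralZl_EFin//; last 2 first.
  - by move=> lam _; rewrite lee_fin prodr_ge0.
  - apply/measurable_EFinP; apply: measurable_prod => j _.
    by apply: measurableT_comp => //; exact: measurable_tnth.
  rewrite /marg_kernel [leRHS]integral_mkcond.
  apply: ge0_le_integral_sup => lam _.
    by rewrite mule_ge0 ?lee_fin ?prodr_ge0.
  have rhs_ge0 (lam' : p.-tuple (measurableTypeR R)) :
      (forall j, (0 < (tnth lam' j : R))%R) ->
      (0 <= (\prod_j local_cond pi_loc tau (bs j ord0) (tnth lam' j))%:E)%E.
    by move=> h; rewrite lee_fin prodr_ge0// => j _; exact/lc_ge0/h.
  (* Either all coordinates are at least [L] and [cond_kernel_ge] applies, or some factor [f j]
     vanishes and the integrand on the right is nonnegative. *)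
  have [lamL|/existsNP[j /negP]] :=
    pselect (forall j, L <= (tnth lam j : R)).
    have lam0 j : 0 < (tnth lam j : R) by exact: lt_le_trans (lamL j).
    rewrite patchE mem_set//= (eq_bigr (fun j =>
      local_cond pi_loc tau (bs j ord0) (tnth lam j))); last first.
      by move=> j _; rewrite /f patchE mem_set//= in_itv/= andbT.
    by rewrite lee_wpmul2r ?rhs_ge0//; exact: cond_kernel_ge.
  rewrite -ltNge => lamL.
  rewrite (bigD1 j)//= {1}/f patchE memNset/= ?mul0r ?mule0; last first.
    by rewrite in_itv/= andbT leNgt lamL.
  apply: erestrict_ge0 => lam' /= lam'0; apply: mule_ge0; last exact: rhs_ge0.
  by apply: integral_ge0 => w _; rewrite lee_fin gauss_pdf_ge0.
apply: le_trans step1; rewrite lee_fin.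
have tail_prod : local_tail pi_loc a L ^+ p <=
    \prod_j local_tail pi_loc (bs j ord0 / tau) L.
  rewrite -[in leLHS](card_ord p) -prodr_const.
  apply: ler_prod => j _; rewrite (ltW (tail0 _ _))//=.
  by apply: local_tail_le => //; exact: bs_ge.
apply: (@le_trans _ _ (C * (tau / (1 + tau) * local_tail pi_loc a L ^+ p))).
  by rewrite le_eqVlt /C; apply/orP; left; apply/eqP; ring.
apply: ler_wpM2l => //; apply: le_trans tail_prod.
(* Here [tau / (1 + tau)] is simply bounded by 1. *)
rewrite ler_piMl ?exprn_ge0 ?(ltW (tail0 _ _))//.
by rewrite ler_pdivrMr ?addr_gt0// mul1r lerDr.
Qed.

End kernel_bounds.

Theorem theorem3p6 (R : realType) (n p : nat)
    (X : 'M[R]_(n, p)) (y : 'cV[R]_n) (zeta : R)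
    (pi_loc : R -> R)
    (PG : R -> probability (measurableTypeR R) R)
    (y01 : forall i, y i 0 = 0 \/ y i 0 = 1)
    (zeta_gt0 : 0 < zeta)
    (pi_loc_meas : measurable_fun (`]0, +oo[ : set (measurableTypeR R)) pi_loc)
    (pi_loc_gt0 : forall l : R, 0 < l -> 0 < pi_loc l)
    (pi_loc_int1 : (\int[lebesgue_measure]_(l in `]0%R, +oo[) (pi_loc l)%:E = 1)%E)
    (PG_law : forall c : R, is_PG c (PG c))
    (r : R) (r_gt0 : 0 < r) :
  (forall eps : R, 0 < eps ->
     exists delta : R -> R,
       gauss_minorization X y zeta PG pi_loc r
         (fun tau => [set bs : 'cV[R]_p | forall j, eps <= `|bs j 0 / tau|])
         delta)
  /\
  ((\int[lebesgue_measure]_(l in `]0%R, +oo[) (l^-1 * pi_loc l)%:E < +oo)%E ->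
     exists delta : R -> R,
       gauss_minorization X y zeta PG pi_loc r (fun=> setT) delta).
Proof.
split=> [eps eps0|int0].
  eexists; apply: (@marg_kernel_minorization _ _ _ _ _ _ _ _ _ _ _ _ r eps) => //.
    exact: ltW.
  exact: local_weight_int_lty.
eexists; apply: (@marg_kernel_minorization _ _ _ _ _ _ _ _ _ _ _ _ r 0) => //.
(* At [a = 0] the exponential factor equals 1, and the required finiteness is the assumption on the
   prior. *)
under eq_integral.
  move=> l _; rewrite /local_weight expr0n/= mul0r oppr0 expR0 mulr1; over.
by [].
Qed.
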